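(* Let $q\geqslant 3$ be an integer and let $\chi$ be a completely even primitive character mod $q$. If $\{\lambda_a\}$ is a bounded family of complex numbers (indexed by the reduced residues $a$ mod $q$), then $$\sum_{m \bmod q}\ \sum_{n \bmod q}\Bigl|\sum_{\substack{a \bmod q\\ \gcd(a,q)=1}}\lambda_a\,\chi(ma+n\overline{a})\Bigr|^{2}\ll q\,\varphi^2(q)\,2^{\omega(q)},$$ where the implied constant depends only on the bound for $\{\lambda_a\}$.
   Context: Here $\overline{a}$ is the multiplicative inverse of $a$ modulo $q$; $m,n$ each run over a complete residue system mod $q$; $\varphi$ is Euler's function, $\varphi^2(q)=(\varphi(q))^2$; $\omega(q)$ is the number of distinct prime divisors of $q$. The notation $f\ll g$ means $|f|\leqslant c\,g$ for some positive constant $c$. Completely even characters: let $q=\prod_{1\leqslant i\leqslant s}p_i^{\alpha_i}$ be the canonical prime factorization of $q$, and write $\chi=\prod_{1\leqslant i\leqslant s}\chi_i$ with $\chi_i$ a character mod $p_i^{\alpha_i}$ for each $i$. The character $\chi$ is called completely even if $\chi_i(-1)=1$ for every $i$. *)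

(* Defs.v *)
From mathcomp Require Export all_boot all_order all_algebra.
From mathcomp Require Export reals.
From mathcomp Require Export complex.

Set Implicit Arguments.
Unset Strict Implicit.
Unset Printing Implicit Defensive.

Import Order.TTheory GRing.Theory Num.Theory.
Local Open Scope ring_scope.

(* Characters are functions on int rather than on 'Z_q: the modulus 1, needed
   below to define primitivity, has no faithful counterpart among the 'Z_q. *)
Record dirichlet_character (R : realType) (q : nat) (chi : int -> R[i]) : Prop :=
  DirichletCharacter {
    dirichletM : forall m n : int, chi (m * n) = chi m * chi n;
    dirichlet_periodic : forall n : int, chi (n + q%:Z) = chi n;
    dirichlet_neq0 : forall n : int, (chi n != 0) = coprimez n q%:Z
  }.

(* chi is not induced by any character psi modulo a proper divisor of q. *)
Definition primitive_character (R : realType) (q : nat) (chi : int -> R[i]) : Prop :=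
  dirichlet_character q chi /\
  forall (d : nat) (psi : int -> R[i]),
    (d %| q)%N -> dirichlet_character d psi ->
    (forall n : int, coprimez n q%:Z -> chi n = psi n) -> d = q.

(* The components chis p are uniquely determined by chi (Chinese remainder
   theorem), so the existential quantifier involves no choice. *)
Definition completely_even (R : realType) (q : nat) (chi : int -> R[i]) : Prop :=
  exists chis : nat -> int -> R[i],
    [/\ forall p : nat, p \in primes q ->
          dirichlet_character (p ^ logn p q) (chis p),
        forall n : int, chi n = \prod_(p <- primes q) chis p n
      & forall p : nat, p \in primes q -> chis p (-1) = 1].

Definition omega (q : nat) : nat := size (primes q).

(* Main.v *)
(* Expand the square and sum over [m, n] first. For fixed units [a, b], the
   substitution [u = m a + n / a] turns that sum into
   [sum_u chi u * conj (sum_n chi (u b / a + n e))] with [e = 1 / b - b / a ^ 2].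
   A primitive character sums to 0 over [v + e Z_q] unless [e = 0], i.e.
   [a ^ 2 = b ^ 2], and then the sum is at most [q phi(q)] in modulus. The
   number of such pairs is [phi(q)] times the number of square roots of 1
   modulo [q], which is at most [2 * 2 ^ omega q]. *)

Require Import Defs.
From mathcomp Require Import all_boot all_order all_algebra.
From mathcomp Require Import fingroup reals complex boolp zify ring.

Set Implicit Arguments.
Unset Strict Implicit.
Unset Printing Implicit Defensive.

Import Order.TTheory GRing.Theory Num.Theory.
Local Open Scope ring_scope.

(** * Dirichlet characters on the integers and primitivity *)

Lemma dirichlet_eqmod (R : realType) (q : nat) (chi : int -> R[i]) (m n : int) :
  dirichlet_character q chi -> (q%:Z %| m - n)%Z -> chi m = chi n.
Proof.
move=> chiP /dvdzP[k mnE].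
have chiDn (j : nat) (x : int) : chi (x + j%:Z * q%:Z) = chi x.
  elim: j x => [|j IHj] x; first by rewrite mul0r addr0.
  have -> : x + j.+1%:Z * q%:Z = x + j%:Z * q%:Z + q%:Z by lia.
  by rewrite (dirichlet_periodic chiP) IHj.
have -> : m = n + k * q%:Z by rewrite -mnE; lia.
case: k {mnE} => j; first exact: chiDn.
rewrite -(chiDn j.+1 (n + Negz j * q%:Z)); congr chi.
by rewrite NegzE; lia.
Qed.

Lemma dirichlet1 (R : realType) (q : nat) (chi : int -> R[i]) :
  dirichlet_character q chi -> chi 1 = 1.
Proof.
move=> chiP; have chi1 : chi 1 != 0.
  by rewrite (dirichlet_neq0 chiP) coprimezE coprime1n.
by apply: (mulfI chi1); rewrite -(dirichletM chiP) !mulr1.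
Qed.

Lemma eq_dvdzB_coprimez (d : nat) (m n : int) :
  (d%:Z %| m - n)%Z -> coprimez m d%:Z = coprimez n d%:Z.
Proof.
rewrite -eqz_mod_dvd => /eqP mn.
by rewrite /coprimez -gcdz_modl mn gcdz_modl.
Qed.

(** Let [k] be the product of the primes dividing [q] but not [n]. Every prime divisor of [q] then
    divides exactly one of [n] and [d * k]: one dividing [n] divides neither [d] nor [k], and any
    other divides [k]. Hence [n + d * k] is coprime to [q]. *)
Lemma coprimez_lift (d q : nat) (n : int) :
  (0 < q)%N -> (d %| q)%N -> coprimez n d%:Z ->
  exists2 m : int, coprimez m q%:Z & (d%:Z %| m - n)%Z.
Proof.
move=> q_gt0 d_q n_d.
pose k := (\prod_(p <- primes q | ~~ (p %| `|n|)%N) p)%N.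
exists (n + d%:Z * k%:Z); last by rewrite addrC addKr dvdz_mulr.
rewrite coprimezE /=; apply/negPn/negP => ncop.
have [p p_pr] : exists2 p, prime p & (p %| gcdn `|(n + d%:Z * k%:Z)%R| q)%N.
  exists (pdiv (gcdn `|(n + d%:Z * k%:Z)%R| q)); last exact: pdiv_dvd.
  apply: pdiv_prime; move: ncop; rewrite /coprime.
  have : (0 < gcdn `|(n + d%:Z * k%:Z)%R| q)%N by rewrite gcdn_gt0 q_gt0 orbT.
  by case: (gcdn _ _) => [|[|]].
rewrite dvdn_gcd => /andP[p_nk p_q].
have p_in : p \in primes q by rewrite mem_primes p_pr q_gt0.
have pZ : (p%:Z %| n + d%:Z * k%:Z)%Z by rewrite dvdzE.
have [p_n|p_n] := boolP (p %| `|n|)%N.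
- have : (p%:Z %| d%:Z * k%:Z)%Z.
    by rewrite -(addKr n (_ * _)) rpredD // rpredN dvdzE.
  rewrite dvdzE abszM Euclid_dvdM // => /orP[p_d|].
    have : (p %| gcdn `|n| d)%N by rewrite dvdn_gcd p_n.
    move: n_d; rewrite coprimezE /= /coprime => /eqP ->.
    by rewrite dvdn1 => /eqP p1; rewrite p1 in p_pr.
  rewrite /k /= big_seq_cond; elim/big_rec: _ => [|r x /andP[r_q r_n] IH].
    by rewrite dvdn1 => /eqP p1; rewrite p1 in p_pr.
  rewrite Euclid_dvdM // => /orP[|//].
  move: r_q; rewrite mem_primes => /andP[r_pr _].
  by rewrite dvdn_prime2 // => /eqP pr; rewrite -pr p_n in r_n.
- have p_k : (p %| k)%N by rewrite /k (big_rem p) //= p_n dvdn_mulr.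
  move/negP: p_n; apply; rewrite -[(p %| _)%N]/(p%:Z %| n)%Z.
  by rewrite -(addrK (d%:Z * k%:Z) n) rpredB // dvdz_mull // dvdzE.
Qed.

(** If [chi] were 1 at every integer coprime to [q] and congruent to 1 modulo [d], it would be
    induced by a character modulo [d], against primitivity. This is the form in which primitivity
    enters the character sums. *)
Lemma primitive_neq1 (R : realType) (q d : nat) (chi : int -> R[i]) :
  (0 < q)%N -> primitive_character q chi -> (d %| q)%N -> d <> q ->
  exists n : int, [/\ coprimez n q%:Z, (d%:Z %| n - 1)%Z & chi n != 1].
Proof.
move=> q_gt0 [chiP chi_prim] d_q; apply: contra_notP => noex.
have chi1 n : coprimez n q%:Z -> (d%:Z %| n - 1)%Z -> chi n = 1.
  move=> n_q n_d; apply/eqP/negPn/negP => chin.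
  by apply: noex; exists n.
have chiE m n : coprimez m q%:Z -> coprimez n q%:Z -> (d%:Z %| m - n)%Z ->
    chi m = chi n.
  (* Here [v] is an inverse of [n] modulo [q]. Since [m * v] is congruent to 1 modulo [d],
     [chi (m * v) = 1 = chi (n * v)], and [chi v] cancels. *)
  move=> m_q n_q mn; have /coprimezP[[v w] /= vw] := n_q.
  have chinv : chi n * chi v = 1.
    rewrite -(dirichletM chiP) -[RHS](dirichlet1 chiP).
    apply: (dirichlet_eqmod chiP); apply/dvdzP; exists (- w); rewrite -vw.
    ring.
  have chiv : chi v != 0.
    apply: contraPneq chinv => ->; rewrite mulr0.
    by apply/eqP; rewrite eq_sym oner_eq0.
  have v_q : coprimez v q%:Z by rewrite -(dirichlet_neq0 chiP).
  apply: (mulIf chiv); rewrite chinv -(dirichletM chiP); apply: chi1.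
    by rewrite coprimezMl m_q.
  have -> : m * v - 1 = (m - n) * v - w * q%:Z by rewrite -vw; ring.
  by apply: rpredB; [exact: dvdz_mulr | rewrite dvdz_mull // dvdzE].
have /choice[lift_ liftP] (n : int) : exists m : int,
    coprimez n d%:Z -> coprimez m q%:Z /\ (d%:Z %| m - n)%Z.
  have [n_d|] := boolP (coprimez n d%:Z); last by exists 0.
  by have [m] := coprimez_lift q_gt0 d_q n_d; exists m.
(* The inducing character evaluates [chi] at a lift coprime to [q]; by [chiE] the value does not
   depend on the lift, which gives multiplicativity and periodicity. *)
pose psi n : R[i] := if coprimez n d%:Z then chi (lift_ n) else 0.
apply: (chi_prim d psi) => //; last first.
  move=> n n_q.
  have n_d : coprimez n d%:Z by apply: coprimez_dvdr n_q.
  have [l_q l_d] := liftP n n_d; rewrite /psi n_d.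
  by apply: chiE => //; rewrite -opprB rpredN.
split.
- move=> m n; rewrite /psi coprimezMl.
  have [m_d|] /= := boolP (coprimez m d%:Z); last by rewrite mul0r.
  have [n_d|] /= := boolP (coprimez n d%:Z); last by rewrite mulr0.
  have mn_d : coprimez (m * n) d%:Z by rewrite coprimezMl m_d.
  have [[l_q l_d] [l'_q l'_d]] := (liftP m m_d, liftP n n_d).
  have [l''_q l''_d] := liftP _ mn_d.
  rewrite -(dirichletM chiP); apply: chiE => //; first by rewrite coprimezMl l_q.
  have -> : lift_ (m * n) - lift_ m * lift_ n = (lift_ (m * n) - m * n) -
     ((lift_ m - m) * lift_ n + m * (lift_ n - n)) by ring.
  by apply: rpredB => //; apply: rpredD; [exact: dvdz_mulr | exact: dvdz_mull].
- move=> n; rewrite /psi.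
  have -> : coprimez (n + d%:Z) d%:Z = coprimez n d%:Z.
    by apply: eq_dvdzB_coprimez; rewrite addrC addKr.
  case: ifP => // n_d.
  have nd_d : coprimez (n + d%:Z) d%:Z.
    by rewrite (@eq_dvdzB_coprimez d _ n) // addrC addKr.
  have [[l_q l_d] [l'_q l'_d]] := (liftP n n_d, liftP _ nd_d).
  apply: chiE => //.
  have -> : lift_ (n + d%:Z) - lift_ n =
    lift_ (n + d%:Z) - (n + d%:Z) - (lift_ n - n) + d%:Z by ring.
  by rewrite rpredD // rpredB.
- move=> n; rewrite /psi; case: ifP => n_d; last by rewrite eqxx.
  by rewrite (dirichlet_neq0 chiP); case: (liftP n n_d).
Qed.

(** * Characters and their sums on the residue ring ['Z_q] *)

Lemma Zp_int_modz (q : nat) (n : int) : (1 < q)%N ->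
  (q%:Z %| (nat_of_ord (n%:~R : 'Z_q))%:Z - n)%Z.
Proof.
move=> q_gt1.
case: n => n.
  rewrite -pmulrn val_Zp_nat //; apply/dvdzP; exists (- (n %/ q)%N%:Z).
  by rewrite [X in _ - X%:Z](divn_eq n q); lia.
rewrite NegzE mulrNz -pmulrn.
set x : 'Z_q := _%:R.
have /(congr1 val) : - x + x = 0 by rewrite addNr.
rewrite /= {2}/x val_Zp_nat // Zp_cast // modnDmr => /eqP; rewrite -/(_ %| _)%N.
by rewrite opprK -PoszD dvdzE.
Qed.

Definition chiZ (R : realType) (q : nat) (chi : int -> R[i]) (x : 'Z_q) : R[i] :=
  chi (nat_of_ord x)%:Z.

Section ResidueRing.
Variables (R : realType) (q : nat) (chi : int -> R[i]).
Hypotheses (q_gt1 : (1 < q)%N) (chiP : dirichlet_character q chi).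

Lemma chiZ_int (n : int) : chiZ chi (n%:~R : 'Z_q) = chi n.
Proof. exact/(dirichlet_eqmod chiP)/Zp_int_modz. Qed.

Lemma chiZM : {morph @chiZ R q chi : x y / x * y}.
Proof.
move=> x y; rewrite -[x]natr_Zp -[y]natr_Zp -natrM !pmulrn !chiZ_int.
by rewrite PoszM (dirichletM chiP).
Qed.

Lemma Zp_unitE (x : 'Z_q) : (x \is a GRing.unit) = coprime x q.
Proof. by rewrite -{1}[x]natr_Zp unitZpE // coprime_sym. Qed.

Lemma chiZ_eq0 (x : 'Z_q) : (chiZ chi x == 0) = (x \isn't a GRing.unit).
Proof.
by rewrite Zp_unitE -[LHS]negbK (dirichlet_neq0 chiP) coprimezE.
Qed.

(** The unit group is finite, so the value at a unit is a root of unity. *)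
Lemma norm_chiZ (x : 'Z_q) : `|chiZ chi x| = (x \is a GRing.unit)%:R.
Proof.
have [x_unit|x_nunit] := boolP (x \is a GRing.unit); last first.
  by apply/eqP; rewrite normr_eq0 chiZ_eq0.
have chiZX n : chiZ chi (x ^+ n) = chiZ chi x ^+ n.
  elim: n => [|n IHn]; last by rewrite !exprS chiZM IHn.
  by rewrite !expr0 -(dirichlet1 chiP) -chiZ_int.
pose u := FinRing.unit 'Z_q x_unit.
have /(congr1 val) : (u ^+ #[u])%g = 1%g by rewrite expg_order.
rewrite FinRing.val_unitX /= => /(congr1 (fun y => `|chiZ chi y|)).
rewrite chiZX normrX -[1 in RHS](expr0 x) chiZX expr0 normr1 => /eqP.
by rewrite pexpr_eq1 ?order_gt0 // => /eqP.
Qed.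

Lemma card_coprime_Zp : #|[pred x : 'Z_q | coprime x q]| = totient q.
Proof.
rewrite -[in RHS](Zp_cast q_gt1) totient_count_coprime big_mkord -sum1_card.
rewrite big_mkcond; apply: eq_bigr => x _.
have -> : coprime (Zp_trunc q).+2 x = coprime q x.
  by congr (coprime _ x); apply: Zp_cast.
by rewrite inE coprime_sym; case: coprime.
Qed.

(* Some unit [c = 1 + k e] has [chi c != 1]; multiplication by [c] permutes
   [v + e Z_q], so it multiplies the sum by [chi c] without changing it. *)
Lemma sum_chiZ_progression (v e : 'Z_q) :
  primitive_character q chi -> e != 0 ->
  \sum_(n : 'Z_q) chiZ chi (v + n * e) = 0.
Proof.
move=> chi_prim e_neq0.
have e_gt0 : (0 < e)%N by rewrite lt0n.
(* As [0 < e < q], this is a proper divisor of [q], so primitivity provides [c] congruent to 1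
   modulo [d] with [chi c != 1]. *)
pose d := gcdn e q.
have d_neq : d <> q.
  move=> dq; have : (d <= e)%N by rewrite dvdn_leq // dvdn_gcdl.
  by rewrite dq leqNgt -[X in (_ < X)%N](Zp_cast q_gt1) ltn_ord.
have [c [c_q c_d chic]] :=
  primitive_neq1 (ltnW q_gt1) chi_prim (dvdn_gcdr e q) d_neq.
have q0 : q%:R = 0 :> 'Z_q by apply: val_inj; rewrite /= val_Zp_nat // modnn.
(* By Bezout [d] is a multiple of [e] modulo [q], hence so is [c - 1]. *)
have [k cE] : exists k : 'Z_q, c%:~R = 1 + k * e.
  have [u [w uw]] := Bezoutz e q.
  case/dvdzP: c_d => j cE; exists (j * u)%:~R.
  have -> : c = 1 + j * (u * e%:Z + w * q%:Z) by rewrite uw -cE; ring.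
  by rewrite !(intrD, intrM) -!pmulrn q0 natr_Zp mulr0 addr0 mulrA.
have c_unit : (c%:~R : 'Z_q) \is a GRing.unit.
  by rewrite -[_ \is a _]negbK -chiZ_eq0 chiZ_int (dirichlet_neq0 chiP).
have /eqP : chi c * \sum_n chiZ chi (v + n * e) = \sum_n chiZ chi (v + n * e).
  (* The shift [k * v] is forced by [c * (v + n * e) = v + (k * v + c * n) * e]. *)
  rewrite mulr_sumr [RHS](reindex (fun n => k * v + c%:~R * n)) /=; last first.
    exists (fun n => (c%:~R)^-1 * (n - k * v)) => n _.
      by rewrite addrC addKr mulKr.
    by rewrite mulVKr // addrC subrK.
  apply: eq_bigr => n _; rewrite -chiZ_int -chiZM; congr chiZ.
  by rewrite cE; ring.
rewrite -[RHS in _ == RHS]mul1r -subr_eq0 -mulrBl mulf_eq0 subr_eq0.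
by rewrite (negPf chic) => /eqP.
Qed.

Lemma norm_sum_chiZ_pair (a b : 'Z_q) :
  primitive_character q chi -> a \is a GRing.unit -> b \is a GRing.unit ->
  `|\sum_(m : 'Z_q) \sum_(n : 'Z_q)
      chiZ chi (m * a + n * a^-1) * (chiZ chi (m * b + n * b^-1))^*|
  <= (a ^+ 2 == b ^+ 2)%:R * (q%:R * (totient q)%:R).
Proof.
move=> chi_prim a_unit b_unit.
pose e := b^-1 - a^-1 ^+ 2 * b.
have aV := divrr a_unit; have bV := divrr b_unit.
have -> : \sum_m \sum_n chiZ chi (m * a + n * a^-1) *
      (chiZ chi (m * b + n * b^-1))^* =
    \sum_u chiZ chi u * (\sum_n chiZ chi (a^-1 * b * u + n * e))^*.
  rewrite exchange_big /=.
  under [RHS]eq_bigr do rewrite rmorph_sum mulr_sumr.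
  rewrite [RHS]exchange_big; apply: eq_bigr => n _ /=.
  (* This solves [u = m * a + n * a^-1] for [m]; substituting in [m * b + n * b^-1] gives
     [a^-1 * b * u + n * e]. *)
  rewrite (reindex (fun u => a^-1 * (u - a^-1 * n))) /=; last first.
    by exists (fun m => m * a + n * a^-1) => m _; ring: aV.
  apply: eq_bigr => u _.
  by congr (_ * Num.conj _); congr chiZ; rewrite /e; ring: aV.
have e_eq0 : (e == 0) = (a ^+ 2 == b ^+ 2).
  have eE : e * (a ^+ 2 * b) = a ^+ 2 - b ^+ 2.
    by rewrite /e; ring: aV bV.
  rewrite -[RHS]subr_eq0 -eE -[in RHS](mul0r (a ^+ 2 * b)).
  by rewrite (inj_eq (mulIr _)) // unitrM unitrX.
have [ab|ab] := boolP (a ^+ 2 == b ^+ 2); last first.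
  rewrite mul0r big1 ?normr0 // => u _.
  by rewrite sum_chiZ_progression ?e_eq0 // rmorph0 mulr0.
have /eqP e0 : e == 0 by rewrite e_eq0.
(* The bound is spread over [u]: each unit [u] is allotted [q], since its inner sum has [q] terms of
   modulus at most 1, and non-units contribute 0. *)
have -> : q%:R * (totient q)%:R =
    \sum_(u : 'Z_q) (coprime u q)%:R * q%:R :> R[i].
  rewrite mulrC -mulr_suml -natr_sum -card_coprime_Zp -sum1_card big_mkcond /=.
  by congr (_%:R * _); apply: eq_bigr => u _; rewrite inE; case: coprime.
rewrite mul1r e0.
apply: le_trans (ler_norm_sum _ _ _) _; apply: ler_sum => u _.
rewrite normrM norm_chiZ Zp_unitE; case: coprime; last by rewrite !mul0r.
rewrite !mul1r norm_conjC; apply: le_trans (ler_norm_sum _ _ _) _.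
apply: le_trans (_ : \sum_(n : 'Z_q) 1 <= _).
  by apply: ler_sum => n _; rewrite norm_chiZ lern1 leq_b1.
by rewrite sumr_const card_ord Zp_cast.
Qed.
End ResidueRing.

(** * Square roots of 1 modulo [q] *)

(* With [u = g u'], [v = g v'] and [g = gcd u v], which divides 2, the prime [p]
   is coprime to [u'] or to [v']. *)
Lemma pfactor_dvd_mul2 (p k : nat) (u v : int) :
  prime p -> ((p ^ k)%N%:Z %| u * v)%Z -> v - u = 2 ->
  ((p ^ k)%N%:Z %| 2 * u)%Z \/ ((p ^ k)%N%:Z %| 2 * v)%Z.
Proof.
move=> p_pr pk_uv vu; pose g := gcdz u v.
have [/dvdzP[u' uE] /dvdzP[v' vE]] : (g %| u)%Z /\ (g %| v)%Z.
  by rewrite dvdz_gcdl dvdz_gcdr.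
have g_2 : 2 = (v' - u') * g by rewrite mulrBl -uE -vE.
have g_neq0 : g != 0 by apply: contraPneq g_2 => ->; rewrite mulr0.
have [[r s] /= rs] : exists rs : int * int, rs.1 * u' + rs.2 * v' = 1.
  have [r [s rs]] := Bezoutz u v; exists (r, s); apply: (mulIf g_neq0).
  by rewrite mul1r -[RHS]rs [X in r * X]uE [X in s * X]vE /=; ring.
have cop (w : int) : ~~ (p %| `|w|)%N -> coprimez (p ^ k)%N%:Z w.
  by move=> p_w; rewrite coprimezE /= coprimeXl // prime_coprime.
(* If [p] does not divide [u'], then [p ^ k] divides [u' * (g * v)] and so [g * v], a divisor of
   [2 * v]. Otherwise [p] does not divide [v'], and the symmetric argument applies. *)
have [p_u|/cop cop_u] := boolP (p %| `|u'|)%N; last first.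
  right; rewrite g_2 -mulrA dvdz_mull // -(Gauss_dvdzr _ cop_u).
  by rewrite mulrA -uE.
left; rewrite g_2 -mulrA dvdz_mull // -(Gauss_dvdzl _ (cop v' _)).
  by rewrite mulrAC (mulrC g) -vE mulrC.
apply/negP => p_v; have : (p%:Z %| r * u' + s * v')%Z.
  by apply: rpredD; rewrite dvdz_mull // dvdzE.
by rewrite rs dvdzE dvdn1 /= => /eqP p1; rewrite p1 in p_pr.
Qed.

(* A square root [x] of 1 is recovered from which of [2 (x - 1) = 0] and
   [2 (x + 1) = 0] holds modulo each prime power dividing [q] exactly, which
   determines [2 x], and from the half of [0, q) containing it. *)
Lemma card_sqrt1_Zp (q : nat) : (1 < q)%N ->
  (#|[pred x : 'Z_q | x ^+ 2 == 1%R]| <= 2 * 2 ^ omega q)%N.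
Proof.
move=> q_gt1; have q_gt0 := ltnW q_gt1.
pose near1 (x : 'Z_q) (p : nat) := ((q`_p)%N%:Z %| 2 * ((x : nat)%:Z - 1))%Z.
pose f (x : 'Z_q) : bool * (omega q).-tuple bool :=
  ((2 * x < q)%N, map_tuple (near1 x) (in_tuple (primes q))).
have sqrt1 (x : 'Z_q) p : x ^+ 2 = 1 -> p \in primes q -> ~~ near1 x p ->
    ((q`_p)%N%:Z %| 2 * ((x : nat)%:Z + 1))%Z.
  move=> x2 p_q; rewrite /near1 p_part => /negbTE x_near.
  have p_pr : prime p by move: p_q; rewrite mem_primes => /andP[].
  suff q_x2 : (q%:Z %| ((x : nat)%:Z - 1) * ((x : nat)%:Z + 1))%Z.
    case: (@pfactor_dvd_mul2 p (logn p q) (x%:Z - 1) (x%:Z + 1)) => //.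
    - apply: dvdz_trans q_x2; rewrite dvdzE /=; exact: pfactor_dvdnn.
    - ring.
    - by rewrite x_near.
  set n := (X in (_ %| X)%Z).
  have n0 : n%:~R = 0 :> 'Z_q.
    rewrite /n intrM intrB intrD -pmulrn natr_Zp -[RHS](subrr (x ^+ 2)) {2}x2.
    by ring.
  by have := Zp_int_modz n q_gt1; rewrite n0 /= sub0r rpredN.
have f_inj : {in [pred x : 'Z_q | x ^+ 2 == 1%R] &, injective f}.
  move=> x y; rewrite !inE => /eqP x2 /eqP y2 [] xy_half /eq_in_map xy_near.
  have /dvdn_partP : forall p, p \in \pi(q) ->
      (q`_p %| `|(2 * ((x : nat)%:Z - (y : nat)%:Z))%R|)%N.
    move=> p p_q; rewrite -[(_ %| _)%N]/((q`_p)%N%:Z %| _)%Z.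
    have := xy_near p p_q; have [y_near|y_far] := boolP (near1 y p) => x_near.
      have -> : 2 * ((x : nat)%:Z - (y : nat)%:Z) =
        2 * ((x : nat)%:Z - 1) - 2 * ((y : nat)%:Z - 1) by ring.
      exact: rpredB.
    have -> : 2 * ((x : nat)%:Z - (y : nat)%:Z) =
      2 * ((x : nat)%:Z + 1) - 2 * ((y : nat)%:Z + 1) by ring.
    by apply: rpredB; apply: sqrt1; rewrite ?x_near.
  move=> /(_ q_gt0) q_xy.
  have x_q : (x < q)%N by rewrite -[X in (_ < X)%N](Zp_cast q_gt1) ltn_ord.
  have y_q : (y < q)%N by rewrite -[X in (_ < X)%N](Zp_cast q_gt1) ltn_ord.
  apply: val_inj => /=.
  (* Both [2 * x] and [2 * y] lie in [[0, q)] or both in [[q, 2 q)], so their difference, a multiple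
     of [q], is 0. *)
  have : (`|(2 * ((x : nat)%:Z - (y : nat)%:Z))%R|%N < q)%N by lia.
  by case/dvdnP: q_xy => [[|j]] xyE; [lia | nia].
rewrite -(card_in_image f_inj); apply: leq_trans (max_card _) _.
by rewrite card_prod card_bool card_tuple card_bool.
Qed.

(** Division by [a] maps these [b] injectively to square roots of 1. *)
Lemma card_sqrt_unit_Zp (q : nat) (a : 'Z_q) : (1 < q)%N -> a \is a GRing.unit ->
  (#|[pred b : 'Z_q | (b \is a GRing.unit) && (a ^+ 2 == b ^+ 2)%R]|
    <= 2 * 2 ^ omega q)%N.
Proof.
move=> q_gt1 a_unit; apply: leq_trans (card_sqrt1_Zp q_gt1).
have aV_unit : a^-1 \is a GRing.unit by rewrite unitrV.
rewrite -(card_image (mulrI aV_unit)).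
apply: subset_leq_card; apply/subsetP => y /imageP[b].
rewrite inE => /andP[_ /eqP ab] ->.
by rewrite inE exprMn -ab exprVn mulVr // unitrX.
Qed.

(** * Expansion of the square and final estimate *)

Local Open Scope complex_scope.

Theorem theorem2 (R : realType) (B : R) :
  exists c : R, 0 < c /\
    forall (q : nat) (chi : int -> R[i]) (lambda : 'Z_q -> R[i]),
      (3 <= q)%N ->
      primitive_character q chi ->
      completely_even q chi ->
      (forall a : 'Z_q, coprime a q -> `|lambda a| <= B%:C) ->
      \sum_(m : 'Z_q) \sum_(n : 'Z_q)
        `| \sum_(a : 'Z_q | coprime a q)
             lambda a * chi (nat_of_ord (m * a + n * a^-1))%:Z | ^+ 2
      <= (c * q%:R * (totient q)%:R ^+ 2 * 2 ^+ omega q)%:C.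
Proof.
(* The 2 comes from the count of square roots and [B ^+ 2] from the two coefficients [lambda];
   adding 1 keeps the constant positive when [B = 0]. *)
exists (2 * B ^+ 2 + 1); split.
  by rewrite ltr_wpDl // mulr_ge0 // exprn_even_ge0.
move=> q chi lambda q_ge3 chi_prim _ lambdaB.
have q_gt1 : (1 < q)%N by apply: leq_trans q_ge3.
have chiP := chi_prim.1.
pose bound : R[i] := q%:R * (totient q)%:R.
pose T (a b : 'Z_q) : R[i] := \sum_(m : 'Z_q) \sum_(n : 'Z_q)
  chiZ chi (m * a + n * a^-1) * Num.conj (chiZ chi (m * b + n * b^-1)).
set S := \sum_m _.
have S_ge0 : 0 <= S.
  by apply: sumr_ge0 => m _; apply: sumr_ge0 => n _; apply: exprn_ge0.
have SE : S = \sum_(a : 'Z_q | coprime a q) \sum_(b : 'Z_q | coprime b q)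
    lambda a * Num.conj (lambda b) * T a b.
  rewrite /S; under eq_bigr => m _.
    under eq_bigr => n _.
      rewrite normCK rmorph_sum big_distrlr /=.
      over.
    rewrite exchange_big; under eq_bigr do rewrite exchange_big /=.
    over.
  rewrite exchange_big; apply: eq_bigr => a _ /=.
  rewrite exchange_big; apply: eq_bigr => b _ /=.
  rewrite mulr_sumr; apply: eq_bigr => m _.
  rewrite mulr_sumr; apply: eq_bigr => n _.
  by rewrite rmorphM mulrACA.
have B2_ge0 : 0 <= (B ^+ 2)%:C by rewrite lecR exprn_even_ge0.
have bound_ge0 : 0 <= bound by rewrite mulr_ge0.
have sum_le (a : 'Z_q) : coprime a q ->
    `|\sum_(b : 'Z_q | coprime b q) lambda a * Num.conj (lambda b) * T a b|
    <= (B ^+ 2)%:C * bound * (2 * 2 ^+ omega q).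
  move=> a_q; have a_unit : a \is a GRing.unit by rewrite Zp_unitE.
  apply: le_trans (ler_norm_sum _ _ _) _.
  apply: le_trans (_ : \sum_(b : 'Z_q | coprime b q)
      (B ^+ 2)%:C * bound * (a ^+ 2 == b ^+ 2)%:R <= _).
    apply: ler_sum => b b_q; rewrite 2!normrM norm_conjC.
    rewrite -[X in _ <= X]mulrA (mulrC bound).
    apply: ler_pM; rewrite ?mulr_ge0 //.
      by rewrite rmorphXn /= expr2; apply: ler_pM; rewrite ?lambdaB.
    by apply: norm_sum_chiZ_pair; rewrite ?Zp_unitE.
  rewrite -mulr_sumr ler_wpM2l ?mulr_ge0 // -natr_sum -natrX -natrM ler_nat.
  apply: leq_trans (card_sqrt_unit_Zp q_gt1 a_unit).
  rewrite -sum1_card big_mkcond [leqRHS]big_mkcond; apply/eq_leq/eq_bigr => b _.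
  by rewrite inE Zp_unitE //; case: coprime; case: (_ == _).
(* One factor [totient q] is already in [bound]; the second counts the units [a]. *)
apply: le_trans (_ : (B ^+ 2)%:C * bound * (2 * 2 ^+ omega q) * (totient q)%:R <= _).
  apply: le_trans (_ : \sum_(a : 'Z_q | coprime a q)
     (B ^+ 2)%:C * bound * (2 * 2 ^+ omega q) <= _).
    apply: le_trans (ler_sum _ sum_le).
    by rewrite -(ger0_norm S_ge0) SE; apply: ler_norm_sum.
  by rewrite sumr_const mulr_natr -(card_coprime_Zp q_gt1).
have -> : (B ^+ 2)%:C * bound * (2 * 2 ^+ omega q) * (totient q)%:R =
  (2 * B ^+ 2 * (q%:R * (totient q)%:R ^+ 2 * 2 ^+ omega q))%:C.
  rewrite /bound !(rmorphM, rmorphXn, rmorph_nat) /=; ring.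
rewrite lecR -!(mulrA (2 * B ^+ 2 + 1)) ler_wpM2r ?lerDl //.
by rewrite !mulr_ge0 ?exprn_ge0.
Qed.
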